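(* The sequence $(u_e(n))_{n\geq 0}$ satisfies the second order linear recurrence equation $$u_e(n+2)-2\,u_e(n+1)-u_e(n)=0,\qquad n\geq 0,$$ with $u_e(0)=0$ and $u_e(1)=1$, and we have $$u_e(n)=\tfrac{\sqrt{2}}{4}(1+\sqrt{2})^n-\tfrac{\sqrt{2}}{4}(1-\sqrt{2})^n=\sum_{k\geq 0}\binom{n}{2k+1}2^k,\qquad n\geq 0.$$ Moreover, its generating function is given by $U_e(z)=-z/(z^2+2z-1)$. Furthermore, for any integer $n\geq 1$, we have $u_a(n)=2u(n-1)$, $u_{ea}(n)=2u_e(n-1)$, and $u_a(0)=u_{ea}(0)=0$.
   Context: $X_n=\{1,\ldots,n\}$ and $\leq_n$ is the total ordering on $X_n$ with $1<_n 2<_n\cdots<_n n$. A weak ordering $\precsim$ on $X$ is a total and transitive binary relation, with symmetric part $\sim$ ($x\sim y$ iff $x\precsim y$ and $y\precsim x$) and asymmetric part $\prec$ ($x\prec y$ iff $x\precsim y$ and not $y\precsim x$). An element $a\in X$ is maximal (resp. minimal) for $\precsim$ if $x\precsim a$ (resp. $a\precsim x$) for all $x\in X$. Given a total ordering $\leq$ on $X$, a weak ordering $\precsim$ on $X$ is weakly single-peaked for $\leq$ if for any $a,b,c\in X$ such that $a<b<c$, we have $b\prec a$ or $b\prec c$ or $a\sim b\sim c$. For $n\geq 1$: $u(n)$ is the number of weak orderings on $X_n$ that are weakly single-peaked for $\leq_n$; $u_e(n)$ is the number of those for which $X_n$ has exactly one minimal element; $u_a(n)$ (for $n\geq 2$)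 is the number of those for which $X_n$ has exactly one maximal element; $u_{ea}(n)$ is the number of those for which $X_n$ has exactly one minimal element and exactly one maximal element, the two elements being distinct. By convention $u(0)=u_e(0)=u_a(0)=u_{ea}(0)=0$ and $u_a(1)=0$. The (ordinary) generating function of a sequence $(s_n)_{n\geq 0}$ is the power series $S(z)=\sum_{n\geq 0}s_n z^n$. *)

(* Defs.v *)
From mathcomp Require Import all_boot all_order all_algebra.

Set Implicit Arguments.
Unset Strict Implicit.
Unset Printing Implicit Defensive.

Import GRing.Theory.

Section WeakOrderings.
Variable T : finType.
Implicit Types (r le : rel T) (a b c x y z : T).

Definition sym_part r x y := r x y && r y x.
Definition asym_part r x y := r x y && ~~ r y x.

Definition weak_ordering r : bool :=
  [forall x, forall y, r x y || r y x] &&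
  [forall x, forall y, forall z, r x y ==> r y z ==> r x z].

Definition minimal r a : bool := [forall x, r a x].
Definition maximal r a : bool := [forall x, r x a].
Definition minimals r : {set T} := [set a | minimal r a].
Definition maximals r : {set T} := [set a | maximal r a].

(* [asym_part le] is the strict order of the total ordering [le]. *)
Definition weakly_single_peaked le r : bool :=
  [forall a, forall b, forall c, asym_part le a b && asym_part le b c ==>
    [|| asym_part r b a, asym_part r b c
      | sym_part r a b && sym_part r b c]].

Lemma weak_orderingP r : reflect (total r /\ transitive r) (weak_ordering r).
Proof.
apply: (iffP andP) => -[tot tr]; split.
- by move=> x y; have /forallP/(_ x)/forallP := tot; apply.
- move=> y x z rxy ryz.
  by move/'forall_'forall_forallP/(_ x y z): tr; rewrite rxy ryz.
- by apply/'forall_forallP.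
- apply/'forall_'forall_forallP => x y z; apply/implyP => rxy.
  by apply/implyP; apply: tr.
Qed.

End WeakOrderings.

(* X_n is represented by 'I_n = {0, ..., n - 1} with its natural order, and a
   binary relation on X_n by its graph, so that relations can be counted. *)
Definition leq_ord_rel n : rel 'I_n := fun i j => i <= j.
Arguments leq_ord_rel : clear implicits.

Definition graph_rel (T : finType) (S : {set T * T}) : rel T :=
  fun x y => (x, y) \in S.

Definition wsp_weak_orderings n : {set {set 'I_n * 'I_n}} :=
  [set S | weak_ordering (graph_rel S) &
           weakly_single_peaked (leq_ord_rel n) (graph_rel S)].

(* The case distinctions on n implement the conventions
   u(0) = u_e(0) = u_a(0) = u_ea(0) = 0 and u_a(1) = 0; without them the
   empty relation would give u(0) = 1 and the full relation u_a(1) = 1. *)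
Definition u n : nat :=
  if n == 0 then 0 else #|wsp_weak_orderings n|.

Definition u_e n : nat :=
  if n == 0 then 0 else
  #|[set S in wsp_weak_orderings n | #|minimals (graph_rel S)| == 1]|.

Definition u_a n : nat :=
  if n <= 1 then 0 else
  #|[set S in wsp_weak_orderings n | #|maximals (graph_rel S)| == 1]|.

Definition u_ea n : nat :=
  if n == 0 then 0 else
  #|[set S in wsp_weak_orderings n |
      [exists a, exists b, [&& minimals (graph_rel S) == [set a],
                               maximals (graph_rel S) == [set b] & a != b]]]|.

(* Formal power series, given by their coefficient sequences. *)
Section FormalPowerSeries.
Local Open Scope ring_scope.
Variable F : fieldType.

Definition fps := nat -> F.

Definition fps_poly (p : {poly F}) : fps := fun n => p`_n.

Definition genfun (s : nat -> nat) : fps := fun n => (s n)%:R.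

Definition fps_mul (a b : fps) : fps :=
  fun n => \sum_(i < n.+1) a i * b (n - i)%N.

(* The first n + 1 coefficients of 1 / a: the Cauchy product of a and 1 / a
   being 1 determines each coefficient from the preceding ones. *)
Fixpoint fps_inv_seq (a : fps) n : seq F :=
  if n is m.+1 then
    let s := fps_inv_seq a m in
    rcons s (- ((a 0%N)^-1 * \sum_(i < m.+1) a (m.+1 - i)%N * s`_i))
  else [:: (a 0%N)^-1].

Definition fps_inv (a : fps) : fps := fun n => (fps_inv_seq a n)`_n.

Definition fps_div (a b : fps) : fps := fps_mul a (fps_inv b).

Lemma size_fps_inv_seq a n : size (fps_inv_seq a n) = n.+1.
Proof. by elim: n => //= n IHn; rewrite size_rcons IHn. Qed.

Lemma nth_fps_inv_seq a n i : (i <= n)%N -> (fps_inv_seq a n)`_i = fps_inv a i.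
Proof.
elim: n => [|n IHn]; first by rewrite leqn0 => /eqP->.
rewrite leq_eqVlt => /predU1P[->//|lt_in].
by rewrite /= nth_rcons size_fps_inv_seq lt_in IHn.
Qed.

Lemma fps_invS a n :
  fps_inv a n.+1 =
    - ((a 0%N)^-1 * \sum_(i < n.+1) a (n.+1 - i)%N * fps_inv a i).
Proof.
rewrite {1}/fps_inv /= nth_rcons size_fps_inv_seq ltnn eqxx.
by congr (- (_ * _)); apply: eq_bigr => i _; rewrite nth_fps_inv_seq // -ltnS.
Qed.

Lemma fps_mulV a :
  a 0%N != 0 -> fps_mul (fps_inv a) a =1 fps_poly 1.
Proof.
move=> a0; case=> [|n]; rewrite /fps_mul /fps_poly coef1.
  by rewrite big_ord1 mulVf.
rewrite big_ord_recr /= subnn fps_invS mulNr mulrAC mulVf // mul1r.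
by under eq_bigr do rewrite mulrC; rewrite subrr.
Qed.

End FormalPowerSeries.

(* Main.v *)
(* In a weakly single-peaked weak ordering of X_n whose elements are not all
   equivalent, every maximal element is an end point, so the set of maximal
   elements is {1}, {n} or {1, n}. Conversely, end points may be put strictly
   above any weakly single-peaked ordering of the remaining elements without
   changing its minimal elements. Deleting the maximal elements is therefore a
   bijection, which yields u_e(n+2) = 2 u_e(n+1) + u_e(n) (when there is only
   one minimal element the elements are not all equivalent) and, keeping only
   the cases {1} and {n}, u_a(n+1) = 2 u(n) and u_ea(n+1) = 2 u_e(n). *)
Require Import Defs.
From mathcomp Require Import all_boot all_order all_algebra.
From mathcomp Require Import classical_sets fsbigop.
From mathcomp Require Import zify ring.

Set Implicit Arguments.
Unset Strict Implicit.
Unset Printing Implicit Defensive.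

(** * Adding and removing a top class *)

(** An element with the most elements below it is maximal: an element not below it would, by
    totality and transitivity, have strictly more below. *)
Lemma weak_ordering_maximal (T : finType) (r : rel T) (x0 : T) :
  weak_ordering r -> exists x, maximal r x.
Proof.
case/weak_orderingP=> tot tr.
case: (arg_maxnP (fun x => #|[set y | r y x]|) (isT : xpredT x0)) => x _ xmax.
exists x; apply/forallP=> y; apply: contraT => nryx.
have rxy : r x y by have := tot x y; rewrite (negPf nryx) orbF.
suff : #|[set z | r z x]| < #|[set z | r z y]|.
  by rewrite ltnNge (xmax y isT : _ <= _).
apply/proper_card/properP; split.
  by apply/fintype.subsetP=> z; rewrite !inE => rzx; apply: tr rxy.
by exists y; rewrite !inE // -[r y y]orbb tot.
Qed.

(* Weak orderings of T' whose set M of maximal elements consists of extreme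
   points correspond to those of T, identified with the complement of M. *)
Section TopExtension.
Variables (T T' : finType) (le : rel T) (le' : rel T') (f : T -> T').
Variable M : {set T'}.
Hypothesis f_inj : injective f.
Hypothesis f_mono : {mono f : x y / le x y >-> le' x y}.
Hypothesis inM : forall y, (y \in M) = (y \notin codom f).
Hypothesis M_extreme :
  forall a b c, asym_part le' a b -> asym_part le' b c -> b \notin M.

Definition top_ext (S : {set T * T}) : {set T' * T'} :=
  [set p | p.2 \in M] :|: [set (f q.1, f q.2) | q in S].

Definition pullback (S : {set T' * T'}) : {set T * T} :=
  [set q | (f q.1, f q.2) \in S].

Lemma top_ext_setC S x y : y \in M -> graph_rel (top_ext S) x y.
Proof. by move=> yM; rewrite /graph_rel inE inE yM. Qed.

Lemma top_ext_im S a b : graph_rel (top_ext S) (f a) (f b) = graph_rel S a b.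
Proof.
rewrite /graph_rel inE inE inM /= codom_f /=.
have pair_inj : injective (fun q : T * T => (f q.1, f q.2)).
  by move=> [x1 x2] [y1 y2] /= [/f_inj-> /f_inj->].
exact: (mem_imset _ (a, b) pair_inj).
Qed.

Lemma top_ext_max S x b : x \in M -> graph_rel (top_ext S) x (f b) = false.
Proof.
move=> xM; rewrite /graph_rel inE inE inM /= codom_f /=.
apply/imsetP=> -[q _ [def_x _]].
by move: xM; rewrite inM def_x codom_f.
Qed.

(** Indexed by the truth value of [y \in M], so that a case on [imMP y] also evaluates this
    membership in the goal. *)
Variant imM_spec : T' -> bool -> Type :=
  | ImM_im a : imM_spec (f a) false
  | ImM_max y of y \in M : imM_spec y true.

Lemma imMP y : imM_spec y (y \in M).
Proof.
case yM: (y \in M); first exact: ImM_max.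
by move/negbT: yM; rewrite inM negbK => /codomP/sig_eqW[a ->]; left.
Qed.

Lemma weak_ordering_top_ext S :
  weak_ordering (graph_rel S) -> weak_ordering (graph_rel (top_ext S)).
Proof.
case/weak_orderingP=> tot tr; apply/weak_orderingP; split.
  move=> x y; case: (imMP y) => [b|{}y yM]; last by rewrite top_ext_setC.
  case: (imMP x) => [a|{}x xM]; last by rewrite orbC top_ext_setC.
  by rewrite !top_ext_im.
move=> y x z.
case: (imMP z) => [c|{}z zM]; last by move=> *; apply: top_ext_setC.
case: (imMP y) => [b|{}y yM]; last by rewrite [graph_rel _ y _]top_ext_max.
case: (imMP x) => [a|{}x xM]; last by rewrite top_ext_max.
by rewrite !top_ext_im; apply: tr.
Qed.

(** By [M_extreme] the middle point is an image. If an outer point lies in [M], the middle one is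
    strictly below it; otherwise all three come from [T]. *)
Lemma wsp_top_ext S : weakly_single_peaked le (graph_rel S) ->
  weakly_single_peaked le' (graph_rel (top_ext S)).
Proof.
move=> wsp; apply/'forall_'forall_forallP=> a b c.
apply/implyP=> /andP[ab bc].
have := M_extreme ab bc; move: ab bc.
case: (imMP b) => // {}b ab bc _.
case: (imMP a) ab => [{}a|{}a aM] ab; last first.
  by rewrite /asym_part top_ext_setC // top_ext_max.
case: (imMP c) bc => [{}c|{}c cM] bc; last first.
  by rewrite /asym_part orbCA top_ext_setC // top_ext_max.
move: ab bc; rewrite /asym_part /sym_part !f_mono !top_ext_im => ab bc.
move/'forall_'forall_forallP/(_ a b c)/implyP: wsp; apply.
by rewrite /asym_part ab.
Qed.

Lemma maximals_top_ext S y0 : y0 \in M -> maximals (graph_rel (top_ext S)) = M.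
Proof.
move=> y0M; apply/finset.setP=> y; rewrite inE; apply/forallP/idP=> [ymax|yM x].
  by case: (imMP y) ymax => // b /(_ y0); rewrite top_ext_max.
exact: top_ext_setC.
Qed.

Lemma card_minimals_top_ext S (t0 : T) :
  #|minimals (graph_rel (top_ext S))| = #|minimals (graph_rel S)|.
Proof.
rewrite -(card_imset _ f_inj); apply: eq_card => y.
rewrite inE; case: (imMP y) => [a|{}y yM]; last first.
  (* The point [t0] provides an image that no element of [M] is below, so elements of [M] are not
     minimal. *)
  apply/forallP/imsetP=> [/(_ (f t0))|[a _ def_y]].
    by rewrite top_ext_max.
  by move: yM; rewrite inM def_y codom_f.
rewrite mem_imset // inE; apply/forallP/forallP=> [amin x|amin x].
  by rewrite -top_ext_im.
case: (imMP x) => [b|{}x xM]; first by rewrite top_ext_im.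
exact: top_ext_setC.
Qed.

Lemma top_extK : cancel top_ext pullback.
Proof.
by move=> S; apply/finset.setP=> -[a b]; rewrite inE; apply: top_ext_im.
Qed.

Lemma pullbackK S : weak_ordering (graph_rel S) ->
  maximals (graph_rel S) = M -> top_ext (pullback S) = S.
Proof.
case/weak_orderingP=> tot tr defM.
have maxM z : z \in M -> forall x, graph_rel S x z.
  by rewrite -defM inE => /forallP.
apply/finset.setP=> -[x y]; rewrite -!/(graph_rel _ x y).
case: (imMP y) => [b|{}y yM]; last by rewrite top_ext_setC ?maxM.
case: (imMP x) => [a|{}x xM]; first by rewrite top_ext_im /graph_rel inE.
(* An image above some element of [M] would be maximal by transitivity, hence in [M]. *)
rewrite top_ext_max //; apply/esym/negP=> rxb.
suff : f b \in M by rewrite inM codom_f.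
rewrite -defM inE; apply/forallP=> z; exact: tr (maxM _ xM z) rxb.
Qed.

Lemma weak_ordering_pullback S :
  weak_ordering (graph_rel S) -> weak_ordering (graph_rel (pullback S)).
Proof.
case/weak_orderingP=> tot tr; apply/weak_orderingP; rewrite /graph_rel; split.
  by move=> x y; rewrite !inE; apply: tot.
by move=> y x z; rewrite !inE; apply: tr.
Qed.

Lemma wsp_pullback S : weakly_single_peaked le' (graph_rel S) ->
  weakly_single_peaked le (graph_rel (pullback S)).
Proof.
move=> wsp; apply/'forall_'forall_forallP=> a b c.
move/'forall_'forall_forallP/(_ (f a) (f b) (f c)): wsp.
by rewrite /asym_part /sym_part !f_mono /graph_rel !inE.
Qed.

Lemma card_wsp_maximals (Q : pred nat) (t0 : T) y0 : y0 \in M ->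
  #|[set S | [&& weak_ordering (graph_rel S),
                 weakly_single_peaked le' (graph_rel S),
                 Q #|minimals (graph_rel S)| & maximals (graph_rel S) == M]]|
  = #|[set S | [&& weak_ordering (graph_rel S),
                   weakly_single_peaked le (graph_rel S)
                 & Q #|minimals (graph_rel S)|]]|.
Proof.
move=> y0M; rewrite -[RHS](card_imset _ (can_inj top_extK)).
apply: eq_card => S; rewrite inE.
apply/and4P/imsetP=> [[wS pS QS /eqP defM]|[S0]].
  exists (pullback S); last by rewrite pullbackK.
  rewrite inE weak_ordering_pullback // wsp_pullback //=.
  by rewrite -(card_minimals_top_ext _ t0) pullbackK.
rewrite inE => /and3P[wS0 pS0 QS0] ->; split.
- exact: weak_ordering_top_ext.
- exact: wsp_top_ext.
- by rewrite card_minimals_top_ext.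
by apply/eqP/(maximals_top_ext _ y0M).
Qed.

End TopExtension.

(** * Counting orderings with a prescribed set of end points as maximal elements *)

Lemma asym_leq_ord n (i j : 'I_n) : asym_part (leq_ord_rel n) i j = (i < j).
Proof. by rewrite /asym_part /leq_ord_rel; lia. Qed.

Lemma wsp_weak_ordering n (S : {set 'I_n * 'I_n}) :
  S \in wsp_weak_orderings n -> weak_ordering (graph_rel S).
Proof. by rewrite inE => /andP[]. Qed.

(** The parameter [Q] treats u ([predT]) and u_e ([pred1 1]) at once, since the top extension
    preserves the number of minimal elements. *)
Definition wsp_minimals (Q : pred nat) n : {set {set 'I_n * 'I_n}} :=
  [set S in wsp_weak_orderings n | Q #|minimals (graph_rel S)|].

Lemma uE n : u n.+1 = #|wsp_minimals predT n.+1|.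
Proof. by apply: eq_card => S; rewrite !inE andbT. Qed.

Lemma u_eE n : u_e n.+1 = #|wsp_minimals (pred1 1) n.+1|.
Proof. by []. Qed.

Lemma card_wsp_minimals_maximals Q n m (f : 'I_m.+1 -> 'I_n)
    (M : {set 'I_n}) y0 :
    {mono f : i j / i <= j} -> (forall y, (y \in M) = (y \notin codom f)) ->
    (forall b : 'I_n, b \in M -> (b == 0 :> nat) || (b == n.-1 :> nat)) ->
    y0 \in M ->
  #|[set S in wsp_minimals Q n | maximals (graph_rel S) == M]|
  = #|wsp_minimals Q m.+1|.
Proof.
move=> f_mono inM M_end y0M.
have f_inj : injective f.
  by move=> i j eq_f; apply/val_inj/eqP; rewrite eqn_leq -!f_mono eq_f leqnn.
have M_extreme (a b c : 'I_n) : asym_part (leq_ord_rel n) a b ->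
    asym_part (leq_ord_rel n) b c -> b \notin M.
  rewrite !asym_leq_ord => ab bc; apply/negP=> /M_end.
  by have := ltn_ord c; lia.
have := @card_wsp_maximals _ _ (leq_ord_rel m.+1) (leq_ord_rel n) f M f_inj
  f_mono inM M_extreme Q ord0 y0 y0M.
by congr (_ = _); apply: eq_card => S; rewrite !inE -!andbA.
Qed.

Lemma codom_lift n (i j : 'I_n.+1) : (j \in codom (lift i)) = (j != i).
Proof.
apply/codomP/idP=> [[k ->]|]; first by rewrite eq_sym neq_lift.
by rewrite eq_sym => /unlift_some[k -> _]; exists k.
Qed.

Lemma leq_lift n (i : 'I_n.+1) : {mono lift i : j k / j <= k}.
Proof. by move=> j k /=; rewrite leq_bump2. Qed.

Lemma card_maximals_end Q n (i : 'I_n.+2) :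
    (i == ord0) || (i == ord_max) ->
  #|[set S in wsp_minimals Q n.+2 | maximals (graph_rel S) == [set i]%SET]|
  = #|wsp_minimals Q n.+1|.
Proof.
move=> i_end.
apply: (@card_wsp_minimals_maximals Q _ _ (lift i) _ i).
- exact: leq_lift.
- by move=> y; rewrite codom_lift negbK inE.
- move=> b; rewrite inE => /eqP->.
  by case/orP: i_end => /eqP->; rewrite eqxx ?orbT.
- by rewrite inE.
Qed.

Lemma card_maximals_ends Q n :
  #|[set S in wsp_minimals Q n.+3 |
       maximals (graph_rel S) == [set ord0; ord_max]%SET]|
  = #|wsp_minimals Q n.+1|.
Proof.
apply: (@card_wsp_minimals_maximals Q _ _ (lift ord0 \o lift ord_max) _ ord0).
- by move=> i j /=; rewrite !leq_bump2.
- move=> y; rewrite finset.in_setU !finset.in_set1.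
  apply/idP/negP=> [y_end /codomP[i def_y]|no_i].
    case/orP: y_end => /eqP def_y'.
      by have := congr1 val (etrans (esym def_y) def_y').
    have := congr1 val (etrans (esym def_y) def_y') => /=.
    by have := ltn_ord i; rewrite /bump; lia.
  apply: contraT; rewrite negb_or => /andP[y0 ymax]; case: no_i.
  apply/codomP.
  (* The composite of the two lifts sends k to k + 1, so an interior point y comes from y - 1. *)
  have y_lt : y.-1 < n.+1.
    by have := ltn_ord y; move: y0 ymax; rewrite -!val_eqE /=; lia.
  exists (Ordinal y_lt); apply/val_inj.
  by move: y0; rewrite -!val_eqE /= /bump; lia.
- by move=> b; rewrite !inE => /orP[] /eqP->; rewrite eqxx ?orbT.
- by rewrite !inE eqxx.
Qed.

(** * Shape of the set of maximal elements *)

(** An interior maximal [b] is strictly below nothing, so single-peakedness leaves only a ~ b ~ c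
    whenever a < b < c. Taking an end point for a or c makes every element equivalent to [b]. *)
Lemma wsp_maximal_end n (S : {set 'I_n.+1 * 'I_n.+1}) (b : 'I_n.+1) :
    S \in wsp_weak_orderings n.+1 -> maximal (graph_rel S) b ->
  [|| b == ord0, b == ord_max | maximals (graph_rel S) == [set: 'I_n.+1]%SET].
Proof.
rewrite inE => /andP[/weak_orderingP[tot tr] wsp] bmax.
case: eqVneq => //= b0; case: eqVneq => //= bn.
have sim (a c : 'I_n.+1) : a < b -> b < c ->
    sym_part (graph_rel S) a b && sym_part (graph_rel S) b c.
  move=> ab bc; move/'forall_'forall_forallP/(_ a b c): wsp.
  have mb x : graph_rel S x b by apply: (forallP bmax).
  by rewrite !asym_leq_ord ab bc /asym_part !mb !andbF.
have lt0b : (ord0 : 'I_n.+1) < b by rewrite lt0n.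
have ltbn : b < (ord_max : 'I_n.+1).
  by rewrite ltn_neqAle -ltnS ltn_ord andbT.
rewrite finset.eqEsubset finset.subsetT; apply/fintype.subsetP=> x _.
suff rbx : graph_rel S b x.
  by rewrite inE; apply/forallP=> z; apply: tr rbx; apply: (forallP bmax).
case: (ltngtP x b) => [xb|bx|/val_inj->].
- by case/andP: (sim _ _ xb ltbn) => /andP[].
- by case/andP: (sim _ _ lt0b bx) => _ /andP[].
- by have := tot b b; rewrite orbb.
Qed.

Lemma set_maximals_end n (S : {set 'I_n.+1 * 'I_n.+1}) :
    S \in wsp_weak_orderings n.+1 ->
    maximals (graph_rel S) != [set: 'I_n.+1]%SET ->
  [|| maximals (graph_rel S) == [set ord0]%SET,
      maximals (graph_rel S) == [set ord_max]%SET
    | maximals (graph_rel S) == [set ord0; ord_max]%SET].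
Proof.
move=> wspS /negPf nT.
have sub b : b \in maximals (graph_rel S) -> (b == ord0) || (b == ord_max).
  by rewrite inE => /(wsp_maximal_end wspS); rewrite nT orbF.
have [x xmax] : exists x, x \in maximals (graph_rel S).
  have [x] := weak_ordering_maximal ord0 (wsp_weak_ordering wspS).
  by exists x; rewrite inE.
(* Two sets of end points are equal once they agree at both ends, which leaves four cases; the empty
   one is excluded by [xmax]. *)
have eqM (M : {set 'I_n.+1}) :
    M \subset [set ord0; ord_max]%SET ->
    (forall b, ((b == ord0) || (b == ord_max)) ->
       (b \in maximals (graph_rel S)) = (b \in M)) ->
    maximals (graph_rel S) == M.
  move=> /fintype.subsetP sM bM; apply/eqP/finset.setP=> b.
  apply/idP/idP=> [bS|bS]; first by rewrite -bM // sub.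
  by rewrite bM //; have := sM b bS; rewrite !inE.
case M0: (ord0 \in maximals (graph_rel S));
  case Mn: (ord_max \in maximals (graph_rel S)).
- apply/or3P/Or33/eqM => // b b_end.
  rewrite finset.in_setU !finset.in_set1 b_end.
  by case/orP: b_end => /eqP->.
- apply/or3P/Or31/eqM => [|b /orP[] /eqP->].
  + by apply/fintype.subsetP=> b; rewrite !inE => ->.
  + by rewrite M0 inE.
  + by rewrite Mn inE; case: eqP Mn => // ->; rewrite M0.
- apply/or3P/Or32/eqM => [|b /orP[] /eqP->].
  + by apply/fintype.subsetP=> b; rewrite !inE => ->; rewrite orbT.
  + by rewrite M0 inE; case: eqP M0 => // ->; rewrite Mn.
  + by rewrite Mn inE eqxx.
- by case/orP: (sub x xmax) => /eqP def_x; rewrite def_x ?M0 ?Mn in xmax.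
Qed.

(** * Recurrences for the counting sequences *)

(** The unique maximal element is either the first or the last point, two disjoint cases of equal
    size. *)
Lemma card_one_maximal Q n :
  #|[set S in wsp_minimals Q n.+2 | #|maximals (graph_rel S)| == 1]|
  = 2 * #|wsp_minimals Q n.+1|.
Proof.
rewrite mul2n -addnn -{1}(@card_maximals_end Q n ord0) //.
rewrite -(@card_maximals_end Q n ord_max) ?eqxx ?orbT //.
rewrite -cardsUI [X in _ = _ + X](_ : _ = 0) ?addn0; last first.
  apply/eqP; rewrite cards_eq0; apply/eqP/finset.setP=> S; rewrite [RHS]inE.
  apply/setIP=> -[/setIdP[_ /eqP M1] /setIdP[_]].
  by rewrite M1 (inj_eq finset.set1_inj).
apply: eq_card => S; apply/setIdP/setUP=> [[SW M1]|]; last first.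
  by case=> /setIdP[SW /eqP->]; rewrite SW cards1.
have wspS : S \in wsp_weak_orderings n.+2 by case/setIdP: SW.
have nT : maximals (graph_rel S) != [set: 'I_n.+2]%SET.
  by apply: contraTneq M1 => ->; rewrite cardsT card_ord.
case/or3P: (set_maximals_end wspS nT) => [M2|M2|/eqP M2].
- by left; apply/setIdP.
- by right; apply/setIdP.
by rewrite M2 cards2 in M1.
Qed.

Lemma u_e_rec n : u_e n.+2 = 2 * u_e n.+1 + u_e n.
Proof.
pose E M :=
  #|[set S in wsp_minimals (pred1 1) n.+2 | maximals (graph_rel S) == M]|.
(* If all elements were maximal, all of them, at least two, would be minimal. *)
have full S : S \in wsp_minimals (pred1 1) n.+2 ->
    maximals (graph_rel S) != [set: 'I_n.+2]%SET.
  rewrite inE => /andP[_ min1]; apply: contraTneq min1 => maxT.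
  suff -> : minimals (graph_rel S) = [set: 'I_n.+2]%SET.
    by rewrite /= cardsT card_ord.
  apply/finset.setP=> x; rewrite !inE; apply/forallP=> y.
  by have := finset.in_setT y; rewrite -maxT inE => /forallP.
have -> : u_e n = E [set ord0; ord_max]%SET.
  (* For n = 0 the two ends are the whole of X_2, a case excluded by [full], in accordance with
     u_e(0) = 0. *)
  case: n @E full => [|n] E full; last by rewrite /E card_maximals_ends -u_eE.
  apply/esym/eqP; rewrite cards_eq0; apply/eqP/finset.setP=> S.
  rewrite [RHS]inE inE; apply/andP=> -[/full nT /eqP M2]; case/eqP: nT.
  rewrite M2; apply/finset.setP=> x; rewrite !inE.
  by case: x => [[|[]]].
rewrite [in RHS]u_eE -card_one_maximal u_eE.
rewrite -cardsUI [X in _ = _ + X](_ : _ = 0) ?addn0; last first.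
  apply/eqP; rewrite cards_eq0; apply/eqP/finset.setP=> S; rewrite [RHS]inE.
  apply/setIP=> -[/setIdP[_ M1] /setIdP[_ /eqP M2]].
  by rewrite M2 cards2 in M1.
apply: eq_card => S; apply/idP/setUP=> [SW|]; last first.
  by case=> /setIdP[].
have wspS : S \in wsp_weak_orderings n.+2 by case/setIdP: SW.
case/or3P: (set_maximals_end wspS (full S SW)) => [/eqP M1|/eqP M1|M2].
- by left; apply/setIdP; rewrite M1 cards1.
- by left; apply/setIdP; rewrite M1 cards1.
by right; apply/setIdP.
Qed.

Lemma u_aE n : u_a n.+2 = 2 * u n.+1.
Proof.
rewrite uE -card_one_maximal; apply: eq_card => S.
by rewrite !inE andbT.
Qed.

Lemma u_eaE n : u_ea n.+2 = 2 * u_e n.+1.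
Proof.
rewrite u_eE -card_one_maximal; apply: eq_card => S.
apply/setIdP/setIdP=> [[wspS /existsP[a /existsP[b]]]|[/setIdP[wspS]]].
  case/and3P=> /eqP mina /eqP maxb _.
  by rewrite maxb cards1; split=> //; apply/setIdP; rewrite mina /= cards1.
move=> /= /cards1P[a mina] /cards1P[b maxb]; split=> //; apply/existsP.
exists a; apply/existsP; exists b; rewrite mina maxb !eqxx /=.
(* An element both minimal and maximal gives x below b below y for all x and y, so every element
   would be minimal. *)
apply/eqP=> def_a; subst a.
have /subset_leq_card : [set: 'I_n.+2]%SET \subset [set b]%SET.
  apply/fintype.subsetP=> x _; rewrite -mina inE; apply/forallP=> y.
  have : b \in minimals (graph_rel S) by rewrite mina inE.
  have : b \in maximals (graph_rel S) by rewrite maxb inE.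
  have /weak_orderingP[_ tr] := wsp_weak_ordering wspS.
  by rewrite !inE => /forallP/(_ x) xb /forallP/(_ y); apply: tr.
by rewrite cardsT card_ord cards1.
Qed.

Lemma u_e1 : u_e 1 = 1.
Proof.
rewrite u_eE; apply/eqP/cards1P; exists [set: 'I_1 * 'I_1]%SET.
apply/finset.setP=> S; rewrite finset.in_set1; apply/setIdP/eqP=> [[wS _]|->].
  have /weak_orderingP[tot _] := wsp_weak_ordering wS.
  apply/finset.setP=> -[i j]; rewrite (ord1 i) (ord1 j) finset.in_setT.
  by have := tot ord0 ord0; rewrite orbb.
have full x y : graph_rel [set: 'I_1 * 'I_1]%SET x y by rewrite /graph_rel inE.
split.
  rewrite inE; apply/andP; split.
    by apply/weak_orderingP; split=> [x y|y x z]; rewrite !full.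
  apply/'forall_'forall_forallP=> a b c.
  by rewrite /sym_part !full /= !orbT implybT.
apply/cards1P; exists ord0; apply/finset.setP=> x.
by rewrite (ord1 x) !inE eqxx; apply/forallP=> y; apply: full.
Qed.

Lemma u_ea1 : u_ea 1 = 0.
Proof.
apply/eqP; rewrite cards_eq0; apply/eqP/finset.setP=> S; rewrite [RHS]inE.
apply/setIdP=> -[_ /existsP[a /existsP[b /and3P[_ _]]]].
by rewrite (ord1 a) (ord1 b).
Qed.

(** * The binomial sum *)

(** With [G] the companion sum over even indices, untruncated sums satisfy (1 + sqrt 2)^n = G(n) +
    F(n) sqrt 2. Pascal's rule gives F(m+1) = F(m) + G(m) and G(n+1) = G(n) + 2 F(n); eliminating
    [G] yields the recurrence. *)
Lemma bin_odd_sum_rec N n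
    (F := fun n => \sum_(k < N) 'C(n, 2 * k + 1) * 2 ^ k) :
  n.+1 < 2 * N -> F n.+2 = 2 * F n.+1 + F n.
Proof.
pose G n := \sum_(k < N) 'C(n, 2 * k) * 2 ^ k.
have FS m : F m.+1 = F m + G m.
  rewrite -big_split; apply: eq_bigr => k _ /=.
  by rewrite addn1 binS mulnDl.
have GS : n.+1 < 2 * N -> G n.+1 = G n + 2 * F n.
  rewrite /G /F; case: N @F @G FS => [|N] _ _ _ ltnN; first by lia.
  rewrite [LHS]big_ord_recl [X in _ = X + _]big_ord_recl /= !muln0 !bin0.
  rewrite -addnA; congr (_ + _).
  rewrite [X in _ = _ + 2 * X]big_ord_recr /=.
  (* Shifting the index in G(n+1) leaves one extra term in F(n), which the bound on n makes zero. *)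
  rewrite (@bin_small n (2 * N + 1)); last by lia.
  rewrite mul0n addn0 big_distrr -big_split; apply: eq_bigr => k _ /=.
  rewrite /bump /= add1n mulnS addnC addn2 binS addn1 expnS.
  by rewrite mulnDl [in X in _ + X = _]mulnCA.
by move=> /GS; rewrite !FS => ->; lia.
Qed.

Lemma bin_odd_fsum N n : n <= 2 * N ->
  (\sum_(k \in [set: nat]%classic) ('C(n, 2 * k + 1) * 2 ^ k)%N)%R
  = \sum_(k < N) 'C(n, 2 * k + 1) * 2 ^ k.
Proof.
move=> leNn.
etransitivity; last first.
  exact/esym/(fsbig_ord _ _ (fun k => 'C(n, 2 * k + 1) * 2 ^ k)).
apply/esym/fsbig_widen=> // k [_ /= /negP]; rewrite -leqNgt => leNk.
by rewrite bin_small //; lia.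
Qed.

Lemma rec2_bin_odd_fsum (v : nat -> nat) :
    v 0 = 0 -> v 1 = 1 -> (forall n, v n.+2 = 2 * v n.+1 + v n) -> forall n,
  v n = (\sum_(k \in [set: nat]%classic) ('C(n, 2 * k + 1) * 2 ^ k)%N)%R.
Proof.
move=> v0 v1 vS n; rewrite (@bin_odd_fsum n.+1); last by lia.
(* One truncation, fixed by n, serves for all m up to n, so that the induction compares sums over
   the same range. *)
suff v_sum m : m <= n -> v m = \sum_(k < n.+1) 'C(m, 2 * k + 1) * 2 ^ k.
  exact: v_sum.
elim/ltn_ind: m => -[|[|m]] IHm le_mn.
- by rewrite v0 big1 // => k _; rewrite addn1.
- rewrite v1 big_ord_recl big1 // => k _.
  by rewrite bin_small // /= /bump; lia.
rewrite bin_odd_sum_rec; last by lia.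
by rewrite vS !IHm //; lia.
Qed.

(** * Closed form and generating function *)

Import Order.TTheory GRing.Theory Num.Theory.
Local Open Scope ring_scope.

Lemma rec2_closed_form (R : rcfType) (v : nat -> nat) :
    v 0%N = 0%N -> v 1%N = 1%N -> (forall n, v n.+2 = 2 * v n.+1 + v n)%N ->
  forall n, (v n)%:R = Num.sqrt 2 / 4 * (1 + Num.sqrt 2) ^+ n
                     - Num.sqrt 2 / 4 * (1 - Num.sqrt 2) ^+ n :> R.
Proof.
move=> v0 v1 vS n.
suff [] : (v n)%:R = Num.sqrt 2 / 4 * (1 + Num.sqrt 2) ^+ n
                     - Num.sqrt 2 / 4 * (1 - Num.sqrt 2) ^+ n :> R
  /\ (v n.+1)%:R = Num.sqrt 2 / 4 * (1 + Num.sqrt 2) ^+ n.+1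
                     - Num.sqrt 2 / 4 * (1 - Num.sqrt 2) ^+ n.+1 :> R by [].
have : Num.sqrt 2 ^+ 2 = 2 :> R by rewrite sqr_sqrtr ?ler0n.
(* Only s^2 = 2 matters from here on: it makes 1 + s and 1 - s the roots of x^2 = 2x + 1. *)
move: (Num.sqrt 2) => s s2.
elim: n => [|n [IHn IHn1]]; split=> //.
- by rewrite v0 !expr0 subrr.
- by rewrite v1 !expr1; transitivity (s ^+ 2 / 2); [rewrite s2|]; field.
rewrite vS natrD natrM IHn1 IHn !exprS.
have eqp : (1 + s) * (1 + s) = 2 * (1 + s) + 1 by ring: s2.
have eqm : (1 - s) * (1 - s) = 2 * (1 - s) + 1 by ring: s2.
by rewrite !(mulrA (1 + s)) !(mulrA (1 - s)) eqp eqm; ring.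
Qed.

Lemma rec2_genfun (F : fieldType) (v : nat -> nat) :
    v 0%N = 0%N -> v 1%N = 1%N -> (forall n, v n.+2 = 2 * v n.+1 + v n)%N ->
  genfun F v =1 fps_div (fps_poly (- 'X)) (fps_poly ('X^2 + 2 *: 'X - 1)).
Proof.
move=> v0 v1 vS n; set d := fps_poly ('X^2 + _ - 1).
have dE k : d k = (k == 2%N)%:R + 2 * (k == 1%N)%:R - (k == 0%N)%:R.
  rewrite /d /fps_poly !coefE.
  by case: k => [|[|[|k]]] /=; ring.
have d0 : d 0%N = -1 by rewrite dE /=; ring.
(* The series -1/d has coefficients v(m+1). Two consecutive ones are carried through the induction
   because the recurrence has order two. *)
have inv_d m : - fps_inv d m = (v m.+1)%:R /\ - fps_inv d m.+1 = (v m.+2)%:R.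
  elim: m => [|m [IHm IHm1]].
    rewrite fps_invS big_ord1 d0 /fps_inv /= d0 vS v0 v1 dE /= invrN1.
    by split; ring.
  (* As [d] has degree 2, only the last two terms of the convolution survive. *)
  split=> //; rewrite fps_invS d0 invrN1 !big_ord_recr /= big1 => [|i _].
    have [-> ->] : (m.+2 - m = 2 /\ m.+2 - m.+1 = 1)%N by lia.
    rewrite add0r !dE vS natrD natrM -IHm -IHm1 /=; ring.
  have := ltn_ord i; rewrite dE => lt_i.
  have [/negPf-> [/negPf-> /negPf->]] :
    (m.+2 - i != 2 /\ m.+2 - i != 1 /\ m.+2 - i != 0)%N by lia.
  by rewrite /=; ring.
rewrite /fps_div /fps_mul /genfun; case: n => [|n].
  by rewrite big_ord1 /fps_poly v0 coefN coefX oppr0 mul0r.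
(* Multiplying by -z keeps only the term of index 1, which shifts the coefficients of -1/d by
   one. *)
rewrite big_ord_recl big_ord_recl big1 => [|i _]; last first.
  by rewrite /fps_poly coefN coefX oppr0 mul0r.
rewrite /fps_poly !coefN !coefX /= oppr0 mul0r add0r addr0 mulN1r subn1.
by rewrite (inv_d n).1.
Qed.

(** * Assembly of the results *)

Theorem proposition4p9 (R : rcfType) :
  (forall n : nat,
     (u_e n.+2)%:Z - 2 * (u_e n.+1)%:Z - (u_e n)%:Z = 0 :> int)
  /\ u_e 0%N = 0%N /\ u_e 1%N = 1%N
  /\ (forall n : nat,
        (u_e n)%:R = Num.sqrt 2 / 4 * (1 + Num.sqrt 2) ^+ n
                     - Num.sqrt 2 / 4 * (1 - Num.sqrt 2) ^+ n :> R
        /\ u_e n = (\sum_(k \in [set: nat]%classic) 'C(n, 2 * k + 1) * 2 ^ k)%N)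
  /\ genfun R u_e =1 fps_div (fps_poly (- 'X)) (fps_poly ('X^2 + 2 *: 'X - 1))
  /\ (forall n : nat, (1 <= n)%N ->
        u_a n = (2 * u (n - 1))%N /\ u_ea n = (2 * u_e (n - 1))%N)
  /\ u_a 0%N = 0%N /\ u_ea 0%N = 0%N.
Proof.
have u_e0 : u_e 0 = 0%N by [].
split; first by move=> n; rewrite u_e_rec PoszD PoszM; ring.
split=> //; split; first exact: u_e1.
split; [|split; [|split=> //]].
- move=> n; split; first exact: rec2_closed_form u_e1 u_e_rec n.
  exact: rec2_bin_odd_fsum u_e1 u_e_rec n.
- exact: rec2_genfun u_e1 u_e_rec.
- case=> [|[|n]] // _; last by rewrite subn1 u_aE u_eaE.
  (* For n = 1 both identities read 0 = 0, by the conventions on u(0), u_e(0) and u_a(1). *)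
  by rewrite subnn u_ea1.
Qed.
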